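(* Let $(H,\alpha)$ be a monoidal Hom-Hopf algebra and let $(A,\beta)$ be a monoidal Hom-algebra in ${}^{H}_{H}\mathcal{HYD}$ with monoidal Hom-subalgebras $X$ and $Y$ which are $H$-commutative and such that $A=X+Y$. Assume that the braiding $C$ is symmetric on $A$. Then $[A,A]$ is nilpotent. If $A$ is also $H$-semiprime, then $A$ is $H$-commutative.
   Context: Everything is over a field $k$; Sweedler-type notation (summation suppressed) is used. Basic objects are pairs $(X,\alpha_X)$ of a $k$-vector space and a linear automorphism; morphisms are linear maps commuting with the automorphisms; $(X,\alpha_X)\otimes(Y,\alpha_Y)=(X\otimes Y,\alpha_X\otimes\alpha_Y)$, with associativity constraint $(x\otimes y)\otimes z\mapsto\alpha_X(x)\otimes(y\otimes\alpha_Z^{-1}(z))$ and unit object $(k,\mathrm{id})$. Monoidal Hom-algebra $(A,\beta)$: a pair with a multiplication and $1_A\in A$ such that $\beta(a)(bc)=(ab)\beta(c)$, $\beta(ab)=\beta(a)\beta(b)$, $a1_A=1_Aa=\beta(a)$, $\beta(1_A)=1_A$. Monoidal Hom-coalgebra $(C,\gamma)$: a pair with $\Delta(c)=c_1\otimes c_2$ and $\epsilon$ such that $\gamma^{-1}(c_1)\otimes\Delta(c_2)=\Delta(c_1)\otimes\gamma^{-1}(c_2)$, $\Delta(\gamma(c))=\gamma(c_1)\otimes\gamma(c_2)$, $c_1\epsilon(c_2)=\epsilon(c_1)c_2=\gamma^{-1}(c)$, $\epsilon(\gamma(c))=\epsilon(c)$. Monoidal Hom-Hopf algebra $(H,\alpha)$: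 both structures (with the same $\alpha$), $\Delta$ and $\epsilon$ multiplicative and unital, and an antipode $S$ with $S\alpha=\alpha S$, $S(h_1)h_2=\epsilon(h)1_H=h_1S(h_2)$. $S$ is assumed bijective with inverse $S^{-1}$. An object $(M,\mu)$ of ${}^{H}_{H}\mathcal{HYD}$ (left-left Hom-Yetter-Drinfeld module) is a pair with a left action satisfying $\alpha(h)\cdot(g\cdot m)=(hg)\cdot\mu(m)$, $1_H\cdot m=\mu(m)$, $\mu(h\cdot m)=\alpha(h)\cdot\mu(m)$, and a left coaction $\rho(m)=m_{(-1)}\otimes m_0\in H\otimes M$ satisfying $\Delta(m_{(-1)})\otimes\mu^{-1}(m_0)=\alpha^{-1}(m_{(-1)})\otimes(m_{0(-1)}\otimes m_{00})$, $\rho(\mu(m))=\alpha(m_{(-1)})\otimes\mu(m_0)$, $\epsilon(m_{(-1)})m_0=\mu^{-1}(m)$, and $\rho(h\cdot m)=(h_{11}\alpha^{-1}(m_{(-1)}))S(h_2)\otimes\alpha(h_{12})\cdot m_0$. Morphisms are $H$-linear, $H$-colinear maps commuting with the structure automorphisms. Tensor products carry $h\cdot(m\otimes n)=h_1\cdot m\otimes h_2\cdot n$ and $\rho(m\otimes n)=m_{(-1)}n_{(-1)}\otimes(m_0\otimes n_0)$. The braiding is $C_{M,N}(m\otimes n)=m_{(-1)}\cdot\nu^{-1}(n)\otimes\mu(m_0)$ for $(M,\mu),(N,\nu)$. A monoidal Hom-algebra in ${}^{H}_{H}\mathcal{HYD}$ is an object $(A,\beta)$ that is a monoidal Hom-algebra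 whose multiplication and unit are morphisms: $h\cdot(ab)=(h_1\cdot a)(h_2\cdot b)$, $h\cdot1_A=\epsilon(h)1_A$, $\rho(ab)=a_{(-1)}b_{(-1)}\otimes a_0b_0$, $\rho(1_A)=1_H\otimes1_A$. Monoidal Hom-subalgebras are taken in ${}^{H}_{H}\mathcal{HYD}$: subspaces $X\subseteq A$ containing $1_A$, closed under multiplication, with $\beta(X)=X$, $H\cdot X\subseteq X$, $\rho(X)\subseteq H\otimes X$. The braiding $C$ is symmetric on $A$ if $a_{(-1)}\cdot\beta^{-1}(b)\otimes\beta(a_0)=\beta(b_0)\otimes S^{-1}(b_{(-1)})\cdot\beta^{-1}(a)$ for all $a,b\in A$. $A$ (or a subalgebra) is $H$-commutative if $(a_{(-1)}\cdot\beta^{-1}(b))\beta(a_0)=ab$ for all its elements $a,b$. The bracket on $A$ is $[a,b]=ab-(a_{(-1)}\cdot\beta^{-1}(b))\beta(a_0)$, and $[A,A]$ is the linear span of all $[a,b]$. A subspace $U$ of $A$ is nilpotent if for some $n\geq1$ all products of $n$ elements of $U$ (with any bracketing) vanish. An $H$-Hom-ideal $U$ of $A$ is a subspace with $H\cdot U\subseteq U$ ($H$-stable), $\rho(U)\subseteq H\otimes U$ ($H$-costable), $\beta(U)\subseteq U$ and $(AU)A=A(UA)\subseteq U$. $A$ is $H$-semiprime if it has no non-zero nilpotent $H$-Hom-ideals. *)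

(* Defs.v *)
From HB Require Import structures.
From mathcomp Require Import all_boot all_order all_algebra.
From mathcomp Require Import mathcomp_extra boolp classical_sets.
From mathcomp Require Import finmap.
From mathcomp.multinomials Require Import monalg.

Set Implicit Arguments.
Unset Strict Implicit.
Unset Printing Implicit Defensive.

Import GRing.Theory.
Local Open Scope classical_set_scope.
Local Open Scope ring_scope.

Reserved Notation "x ⊗ y" (at level 38, right associativity).
Reserved Notation "\tsum_ ( x ⊗ y <- t ) F"
  (at level 41, x name, y name, t at level 200, F at level 41,
   format "'[' \tsum_ ( x  ⊗  y  <-  t ) '/  '  F ']'").

Section Subspaces.
Context {k : fieldType} {M : lmodType k}.

Definition subspace (U : set M) : Prop :=
  U 0 /\ forall (a : k) x y, U x -> U y -> U (a *: x + y).

Definition span (S : set M) : set M := smallest subspace S.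

Lemma span_subspace (S : set M) : subspace (span S).
Proof.
split=> [U [[U0 _] _] //|a x y Sx Sy U hU].
by case: (hU) => -[_ UD] _; apply: UD; [exact: Sx | exact: Sy].
Qed.

Lemma sub_span (S : set M) : S `<=` span S.
Proof. by move=> x Sx U [_]; apply. Qed.

Lemma span_min (S U : set M) : subspace U -> S `<=` U -> span S `<=` U.
Proof. by move=> hU SU x; apply. Qed.

Lemma span_ind (S : set M) (P : M -> Prop) :
    P 0 -> (forall x, S x -> P x) ->
    (forall a x y, P x -> P y -> P (a *: x + y)) ->
  forall x, span S x -> P x.
Proof. by move=> P0 PS PD x; apply; split. Qed.

End Subspaces.

(* U ⊗ V is the free k-module on U * V modulo the span of the bilinearity     *)
(* relators.                                                                  *)
Section TensorProduct.
Context {k : fieldType}.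
Variables U V : lmodType k.

Local Notation free := {malg k[(U * V)%type]}.
Local Notation gen u v := (<< (u, v) >> : free).

Definition tensor_relators : set free :=
  [set r | (exists a u u' v,
              r = gen (a *: u + u') v - (a *: gen u v + gen u' v)) \/
           (exists a u v v',
              r = gen u (a *: v + v') - (a *: gen u v + gen u v'))].

Definition tensor_rel : {pred free} := fun r => `[< span tensor_relators r >].

Lemma tensor_relP r : reflect (span tensor_relators r) (r \in tensor_rel).
Proof. exact: asboolP. Qed.

Lemma tensor_relZD a x y :
  x \in tensor_rel -> y \in tensor_rel -> a *: x + y \in tensor_rel.
Proof.
move=> /tensor_relP hx /tensor_relP hy; apply/tensor_relP.
by apply: (proj2 (span_subspace _)).
Qed.

Lemma tensor_rel_zmod_closed : zmod_closed tensor_rel.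
Proof.
have h0 : 0 \in tensor_rel.
  by apply/tensor_relP; apply: (proj1 (span_subspace _)).
split=> // x y hx hy.
by rewrite -scaleN1r addrC tensor_relZD.
Qed.

HB.instance Definition _ :=
  GRing.isZmodClosed.Build free tensor_rel tensor_rel_zmod_closed.

Lemma tensor_relZ a x : x \in tensor_rel -> a *: x \in tensor_rel.
Proof. by move=> hx; rewrite -[_ *: _]addr0 tensor_relZD ?rpred0. Qed.


Definition tensor : Type := Quotient.quot tensor_rel.

HB.instance Definition _ := GRing.Zmodule.on tensor.

Local Open Scope quotient_scope.

Local Notation pi := (\pi_(Quotient.quot tensor_rel)).

Definition tensor_scale (a : k) (t : tensor) : tensor :=
  pi (a *: (repr t : free)).

Lemma tensor_eqP (x y : free) :
  reflect (pi x = pi y) (x - y \in tensor_rel).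
Proof. by rewrite Quotient.idealrBE; apply: eqP. Qed.

Lemma tensor_piD (x y : free) : (pi (x + y) : tensor) = pi x + pi y.
Proof. exact: pi_addr. Qed.

Lemma tensor_piZ a (x : free) : pi (a *: x) = tensor_scale a (pi x).
Proof.
apply/tensor_eqP; rewrite -scalerBr tensor_relZ //.
by apply/tensor_eqP; rewrite reprK.
Qed.

Lemma tensor_reprK (t : tensor) : (pi (repr t : free) : tensor) = t.
Proof. exact: reprK. Qed.

Lemma tensor_scaleA a b t :
  tensor_scale a (tensor_scale b t) = tensor_scale (a * b) t.
Proof. by rewrite -[t]tensor_reprK -!tensor_piZ scalerA. Qed.

Lemma tensor_scale1 : left_id 1 tensor_scale.
Proof. by move=> t; rewrite -[t]tensor_reprK -tensor_piZ scale1r. Qed.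

Lemma tensor_scaleDr : right_distributive tensor_scale +%R.
Proof.
move=> a s t; rewrite -[s]tensor_reprK -[t]tensor_reprK.
by rewrite -tensor_piD -!tensor_piZ scalerDr tensor_piD.
Qed.

Lemma tensor_scaleDl t : {morph tensor_scale^~ t : a b / a + b}.
Proof.
move=> a b; rewrite -[t]tensor_reprK -!tensor_piZ.
by rewrite scalerDl tensor_piD.
Qed.

HB.instance Definition _ := GRing.Zmodule_isLmodule.Build k tensor
  tensor_scaleA tensor_scale1 tensor_scaleDr tensor_scaleDl.

Lemma tensor_pi_linear a (x y : free) :
  (pi (a *: x + y) : tensor) = a *: (pi x : tensor) + (pi y : tensor).
Proof. by rewrite tensor_piD tensor_piZ. Qed.

Definition pure_tensor (u : U) (v : V) : tensor := pi (gen u v).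

Lemma pure_tensor_bilinear : bilinear_for *:%R *:%R pure_tensor.
Proof.
split=> [v a u u'|u a v v'] /=; rewrite /pure_tensor.
  apply: etrans (tensor_pi_linear _ _ _).
  apply/tensor_eqP/tensor_relP; apply: sub_span; rewrite /tensor_relators /=.
  by left; exists a, u, u', v.
apply: etrans (tensor_pi_linear _ _ _).
apply/tensor_eqP/tensor_relP; apply: sub_span; rewrite /tensor_relators /=.
by right; exists a, u, v, v'.
Qed.

(* Sweedler notation: the value at t of the map U ⊗ V -> W induced by f,      *)
(* computed on a representative of t. It is independent of this choice as     *)
(* soon as f is bilinear, cf. sweedler_pure, sweedler_linear.                 *)
Definition sweedler {W : lmodType k} (t : tensor) (f : U -> V -> W) : W :=
  \sum_(p <- msupp (repr t : free)) (repr t : free)@_p *: f p.1 p.2.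

Section Lift.
Variables (W : lmodType k) (f : U -> V -> W).

Definition free_lift (r : free) : W := \sum_(p <- msupp r) r@_p *: f p.1 p.2.

Lemma free_liftE (D : {fset (U * V)%type}) (r : free) :
  (msupp r `<=` D)%fset -> free_lift r = \sum_(p <- D) r@_p *: f p.1 p.2.
Proof.
move=> /fsubsetP rD; rewrite /free_lift (big_fset_incl _ (B := D)) //=.
  exact/fsubsetP.
by move=> p _ /mcoeff_outdom ->; rewrite scale0r.
Qed.

Lemma free_lift_linear : linear free_lift.
Proof.
move=> a x y; set D := (msupp x `|` msupp y `|` msupp (a *: x + y))%fset.
rewrite (@free_liftE D) ?(@free_liftE D x) ?(@free_liftE D y) //;
  try by apply/fsubsetP => p hp; rewrite !in_fsetU hp ?orbT.
rewrite scaler_sumr -big_split /=; apply: eq_bigr => p _.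
by rewrite mcoeffD mcoeffZ scalerDl scalerA.
Qed.

Lemma free_lift_gen u v : free_lift (gen u v) = f u v.
Proof.
by rewrite (free_liftE (@msuppU_le _ _ _ _)) big_seq_fset1 mcoeffUU scale1r.
Qed.

Hypothesis f_bilinear : bilinear_for *:%R *:%R f.

Lemma free_lift_rel r : r \in tensor_rel -> free_lift r = 0.
Proof.
have [fl fr] := f_bilinear.
pose fll : {linear free -> W} :=
  HB.pack free_lift (GRing.isLinear.Build _ _ _ _ _ free_lift_linear).
have e x : free_lift x = fll x by [].
move=> /tensor_relP; move: r; apply: span_ind => [|r|a x y].
- by rewrite e linear0.
- case=> [[a [u [u' [v ->]]]]|[a [u [v [v' ->]]]]].
    rewrite e linearB linearP -!e !free_lift_gen; apply/eqP; rewrite subr_eq0.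
    by apply/eqP; exact: fl.
  rewrite e linearB linearP -!e !free_lift_gen; apply/eqP; rewrite subr_eq0.
  by apply/eqP; exact: fr.
- by rewrite free_lift_linear => -> ->; rewrite scaler0 addr0.
Qed.

Lemma sweedler_pi (r : free) : sweedler (pi r) f = free_lift r.
Proof.
have h : repr (pi r) - r \in tensor_rel by apply/tensor_eqP; rewrite reprK.
have := free_lift_rel h.
rewrite addrC -scaleN1r free_lift_linear scaleN1r => /eqP.
by rewrite addrC subr_eq0 => /eqP.
Qed.

Lemma sweedler_pure u v : sweedler (pure_tensor u v) f = f u v.
Proof. by rewrite sweedler_pi free_lift_gen. Qed.

Lemma sweedler_linear : linear (fun t => sweedler t f).
Proof.
move=> a s t; rewrite -[s in LHS]tensor_reprK -[t in LHS]tensor_reprK.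
by rewrite -tensor_pi_linear sweedler_pi free_lift_linear -!sweedler_pi
  !tensor_reprK.
Qed.

End Lift.

Lemma tensor_ind (P : tensor -> Prop) :
    P 0 -> (forall u v, P (pure_tensor u v)) ->
    (forall a s t, P s -> P t -> P (a *: s + t)) ->
  forall t, P t.
Proof.
move=> P0 Pp PD t; rewrite -[t]tensor_reprK; move: (repr t : free) => r.
rewrite [r in pi r]monalgE; elim: (X in \sum_(_ <- X) _) => [|p s IH].
  have e0 : (pi 0 : tensor) = 0 by exact: pi_zeror.
  by rewrite big_nil e0.
rewrite big_cons (_ : << _ *g p >> = r@_p *: gen p.1 p.2).
  by rewrite tensor_pi_linear; apply: PD => //; exact: Pp.
apply/malgP => q; rewrite mcoeffZ !mcoeffU -surjective_pairing.
by case: eqP; rewrite ?mulr1 ?mulr0.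
Qed.

End TensorProduct.

Notation "U ⊗ V" := (tensor U V) : type_scope.
Notation "u ⊗ v" := (pure_tensor u v) : ring_scope.
Notation "\tsum_ ( x ⊗ y <- t ) F" := (sweedler t (fun x y => F)) : ring_scope.

Record homObject (k : fieldType) := HomObject {
  hom_carrier :> lmodType k;
  aut : {linear hom_carrier -> hom_carrier};
  autV : {linear hom_carrier -> hom_carrier};
  autK : cancel aut autV;
  autVK : cancel autV aut
}.
Arguments aut {k} X : rename.
Arguments autV {k} X : rename.

Record is_hom_algebra (k : fieldType) (A : homObject k)
    (mul : A -> A -> A) (one : A) : Prop := {
  hom_mulA : forall a b c, mul (aut A a) (mul b c) = mul (mul a b) (aut A c);
  hom_autM : forall a b, aut A (mul a b) = mul (aut A a) (aut A b);
  hom_mulr1 : forall a, mul a one = aut A a;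
  hom_mul1r : forall a, mul one a = aut A a;
  hom_aut1 : aut A one = one
}.

(* Threefold tensors are all written in C ⊗ (C ⊗ C), along the usual          *)
(* identification (x ⊗ y) ⊗ z = x ⊗ (y ⊗ z) of vector spaces.                 *)
Record is_hom_coalgebra (k : fieldType) (C : homObject k)
    (Delta : C -> C ⊗ C) (eps : C -> k) : Prop := {
  hom_coassoc : forall c,
    \tsum_(c1 ⊗ c2 <- Delta c) (autV C c1 ⊗ Delta c2) =
    \tsum_(c1 ⊗ c2 <- Delta c) \tsum_(c11 ⊗ c12 <- Delta c1)
      (c11 ⊗ (c12 ⊗ autV C c2));
  hom_comul_aut : forall c,
    Delta (aut C c) = \tsum_(c1 ⊗ c2 <- Delta c) (aut C c1 ⊗ aut C c2);
  hom_counitr : forall c, \tsum_(c1 ⊗ c2 <- Delta c) (eps c2 *: c1) = autV C c;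
  hom_counitl : forall c, \tsum_(c1 ⊗ c2 <- Delta c) (eps c1 *: c2) = autV C c;
  hom_counit_aut : forall c, eps (aut C c) = eps c
}.

Record homHopf (k : fieldType) := HomHopf {
  hopf_object :> homObject k;
  hmul : {bilinear hopf_object -> hopf_object -> hopf_object};
  hone : hopf_object;
  comul : {linear hopf_object -> (hopf_object ⊗ hopf_object)%type};
  counit : {scalar hopf_object};
  antipode : {linear hopf_object -> hopf_object};
  antipodeV : {linear hopf_object -> hopf_object};
  hopf_algebra : is_hom_algebra hmul hone;
  hopf_coalgebra : is_hom_coalgebra comul counit;
  comulM : forall h g, comul (hmul h g) =
    \tsum_(h1 ⊗ h2 <- comul h) \tsum_(g1 ⊗ g2 <- comul g)
      (hmul h1 g1 ⊗ hmul h2 g2);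
  comul1 : comul hone = hone ⊗ hone;
  counitM : forall h g, counit (hmul h g) = counit h * counit g;
  counit1 : counit hone = 1;
  antipode_aut : forall h,
    antipode (aut hopf_object h) = aut hopf_object (antipode h);
  antipodel : forall h,
    \tsum_(h1 ⊗ h2 <- comul h) hmul (antipode h1) h2 = counit h *: hone;
  antipoder : forall h,
    \tsum_(h1 ⊗ h2 <- comul h) hmul h1 (antipode h2) = counit h *: hone;
  antipodeK : cancel antipode antipodeV;
  antipodeVK : cancel antipodeV antipode
}.
Arguments hone {k} H : rename.
Arguments hmul {k H} : rename.
Arguments comul {k H} : rename.
Arguments counit {k H} : rename.
Arguments antipode {k H} : rename.
Arguments antipodeV {k H} : rename.

Record homYDModule (k : fieldType) (H : homHopf k) := HomYDModule {
  hyd_object :> homObject k;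
  act : {bilinear H -> hyd_object -> hyd_object};
  coact : {linear hyd_object -> (H ⊗ hyd_object)%type};
  actA : forall h g m,
    act (aut H h) (act g m) = act (hmul h g) (aut hyd_object m);
  act1 : forall m, act (hone H) m = aut hyd_object m;
  aut_act : forall h m,
    aut hyd_object (act h m) = act (aut H h) (aut hyd_object m);
  coactA : forall m,
    \tsum_(m1 ⊗ m0 <- coact m) \tsum_(m11 ⊗ m12 <- comul m1)
      (m11 ⊗ (m12 ⊗ autV hyd_object m0)) =
    \tsum_(m1 ⊗ m0 <- coact m) (autV H m1 ⊗ coact m0);
  coact_aut : forall m, coact (aut hyd_object m) =
    \tsum_(m1 ⊗ m0 <- coact m) (aut H m1 ⊗ aut hyd_object m0);
  coact_counit : forall m,
    \tsum_(m1 ⊗ m0 <- coact m) (counit m1 *: m0) = autV hyd_object m;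
  coact_act : forall h m, coact (act h m) =
    \tsum_(h1 ⊗ h2 <- comul h) \tsum_(h11 ⊗ h12 <- comul h1)
      \tsum_(m1 ⊗ m0 <- coact m)
        (hmul (hmul h11 (autV H m1)) (antipode h2) ⊗ act (aut H h12) m0)
}.
Arguments act {k H M} : rename.
Arguments coact {k H M} : rename.

Record homYDAlgebra (k : fieldType) (H : homHopf k) := HomYDAlgebra {
  hyd_module :> homYDModule H;
  amul : {bilinear hyd_module -> hyd_module -> hyd_module};
  aone : hyd_module;
  hyd_hom_algebra : is_hom_algebra amul aone;
  act_mul : forall h a b, act h (amul a b) =
    \tsum_(h1 ⊗ h2 <- comul h) amul (act h1 a) (act h2 b);
  act_one : forall h, act h aone = counit h *: aone;
  coact_mul : forall a b, coact (amul a b) =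
    \tsum_(a1 ⊗ a0 <- coact a) \tsum_(b1 ⊗ b0 <- coact b)
      (hmul a1 b1 ⊗ amul a0 b0);
  coact_one : coact aone = hone H ⊗ aone
}.
Arguments amul {k H A} : rename.
Arguments aone {k H} A : rename.

Section HomYDAlgebraTheory.
Context {k : fieldType} {H : homHopf k} {A : homYDAlgebra H}.
Implicit Types (a b : A) (U V X : set A).

Definition H_stable U : Prop := forall (h : H) a, U a -> U (act h a).

(* the image of H ⊗ U in H ⊗ A *)
Definition tensor_sub U : set (H ⊗ A) :=
  span [set t | exists (h : H) a, U a /\ t = h ⊗ a].

Definition H_costable U : Prop := forall a, U a -> tensor_sub U (coact a).

Record hom_subalgebra X : Prop := {
  hsub_subspace : subspace X;
  hsub_one : X (aone A);
  hsub_mul : forall a b, X a -> X b -> X (amul a b);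
  hsub_aut : aut A @` X = X;
  hsub_stable : H_stable X;
  hsub_costable : H_costable X
}.

(* The right-hand side is the inverse braiding applied to a ⊗ b.              *)
Definition braiding_symmetric : Prop := forall a b,
  \tsum_(a1 ⊗ a0 <- coact a) (act a1 (autV A b) ⊗ aut A a0) =
  \tsum_(b1 ⊗ b0 <- coact b) (aut A b0 ⊗ act (antipodeV b1) (autV A a)).

(* the multiplication precomposed with the braiding *)
Definition braided_mul a b : A :=
  \tsum_(a1 ⊗ a0 <- coact a) amul (act a1 (autV A b)) (aut A a0).

Definition H_commutative X : Prop :=
  forall a b, X a -> X b -> braided_mul a b = amul a b.

Definition bracket a b : A := amul a b - braided_mul a b.

Definition commutator_span : set A :=
  span [set c | exists a b, c = bracket a b].

Inductive product_of U : nat -> A -> Prop :=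
| product_of1 a : U a -> product_of U 1 a
| product_ofM m n a b :
    product_of U m a -> product_of U n b -> product_of U (m + n) (amul a b).

Definition nilpotent U : Prop :=
  exists2 n : nat, (1 <= n)%N & forall a, product_of U n a -> a = 0.

Definition mul_span U V : set A :=
  span [set c | exists a b, [/\ U a, V b & c = amul a b]].

Record H_hom_ideal U : Prop := {
  hideal_subspace : subspace U;
  hideal_stable : H_stable U;
  hideal_costable : H_costable U;
  hideal_aut : forall a, U a -> U (aut A a);
  hideal_mulA :
    mul_span (mul_span setT U) setT = mul_span setT (mul_span U setT);
  hideal_mul : mul_span (mul_span setT U) setT `<=` U
}.

Definition H_semiprime : Prop :=
  forall U, H_hom_ideal U -> nilpotent U -> U `<=` [set 0].

End HomYDAlgebraTheory.

Arguments braiding_symmetric {k H} A.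
Arguments commutator_span {k H} A.
Arguments H_semiprime {k H} A.

(* Main.v *)
(* Replacing a product by its composite with the inverse automorphism, and a   *)
(* coproduct or coaction by its precomposition with the automorphism, turns    *)
(* (H, α) into an ordinary Hopf algebra and A into an ordinary algebra in its  *)
(* Yetter-Drinfeld modules, with the same braiding C; write m for the product. *)
(* As in the classical theorem on sums of two commutative subrings, [A,A]^2=0. *)
(* Up to the invertible braiding, a generator of [X,Y][X,Y] comes from         *)
(* b ⊗ c ⊗ a ⊗ d with b, d in Y and c, a in X. With z = bc = x + y and         *)
(* w = ad = u + v (x, u in X and y, v in Y), the four terms of the product of  *)
(* brackets become (mC(z ⊗ a))d = xw + mC(y ⊗ w), mC(z ⊗ w), zw and            *)
(* b(mC(c ⊗ w)) = zu + mC(z ⊗ v), and their signed sum vanishes because X and  *)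
(* Y are H-commutative. The Leibniz rule for [a,bc] then gives                 *)
(* [A,A]A[A,A] = 0, so that A[A,A] is an H-Hom-ideal of square zero containing *)
(* [A,A].                                                                      *)
Require Import Defs.
From mathcomp Require Import all_boot all_order all_algebra.
From mathcomp Require Import classical_sets.

Set Implicit Arguments.
Unset Strict Implicit.
Unset Printing Implicit Defensive.

Import GRing.Theory.
Local Open Scope classical_set_scope.
Local Open Scope ring_scope.

(** * Multilinear maps and Sweedler sums *)

Section Multilinear.
Context {k : fieldType}.
Implicit Types U V W Z : lmodType k.

(** Composing products and actions with the inverse automorphisms, and coproducts and coactions with
    the automorphisms, removes the twist ([umul], [ucomul], [uact], [ucoact], [uamul]). The
    Hom-axioms become those of an ordinary Hopf algebra and of an ordinary algebra in its
    Yetter-Drinfeld modules; the braiding C is unchanged, and brackets change only by β. Then C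
    satisfies the hexagon identities ([braid_mull], [braid_mulr]), exchanges tensor factors lying in
    subalgebras ([braid_sub]), and the symmetry hypothesis gives C² = id ([braidK]).

    The heart is [A,A]² = 0 ([ubracket_mul]). The bracket changes sign under C, so [alternating_eq0]
    reduces [a,b][c,d] = 0 to a, c in X and b, d in Y. Moving a past b and c gives an expression on
    b ⊗ c ⊗ a ⊗ d which is governed by bc and ad; splitting these two products along A = X + Y,
    commutativity of X and of Y makes all terms cancel ([braid3_bracket_mul]).

    The Leibniz rule [ubracket_mulr] upgrades this to [A,A]A[A,A] = 0 ([ubracket_mul_mul]). Hence
    A[A,A] ([bracket_ideal]) is an H-Hom-ideal of square zero containing every bracket, and
    semiprimeness kills it.

    Linearity is an unbundled predicate because the functions under Sweedler sums are bare lambda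
    terms, whose linearity [linear_tac] reads off from their shape. *)

Definition lin U V (f : U -> V) : Prop :=
  forall a x y, f (a *: x + y) = a *: f x + f y.

Definition bilin U V W (f : U -> V -> W) : Prop :=
  (forall v, lin (fun u => f u v)) /\ (forall u, lin (f u)).

Definition trilin U V W Z (f : U -> V -> W -> Z) : Prop :=
  (forall v w, lin (fun u => f u v w)) /\ (forall u, bilin (f u)).

Lemma bilinP U V W (f : U -> V -> W) : bilin f -> bilinear_for *:%R *:%R f.
Proof. by case=> fl fr; split=> [v|u] a x y; [apply: fl | apply: fr]. Qed.

Lemma linD U V (f : U -> V) : lin f -> {morph f : x y / x + y}.
Proof. by move=> fl x y; have := fl 1 x y; rewrite !scale1r. Qed.

Lemma lin0 U V (f : U -> V) : lin f -> f 0 = 0.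
Proof. by move=> fl; apply: (addrI (f 0)); rewrite -linD // !addr0. Qed.

Lemma linZ U V (f : U -> V) : lin f -> forall a, {morph f : x / a *: x}.
Proof. by move=> fl a x; have := fl a x 0; rewrite (lin0 fl) !addr0. Qed.

Lemma linN U V (f : U -> V) : lin f -> {morph f : x / - x}.
Proof. by move=> fl x; rewrite -scaleN1r linZ // scaleN1r. Qed.

Lemma linB U V (f : U -> V) : lin f -> {morph f : x y / x - y}.
Proof. by move=> fl x y; rewrite linD // linN. Qed.

Lemma lin_sum U V (f : U -> V) I (r : seq I) (G : I -> U) :
  lin f -> f (\sum_(i <- r) G i) = \sum_(i <- r) f (G i).
Proof.
by move=> fl; elim: r => [|i r IH]; rewrite ?big_nil ?lin0 // !big_cons linD // IH.
Qed.

Lemma lin_id U : lin (fun x : U => x).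
Proof. by []. Qed.

Lemma lin_comp U V W (g : {linear V -> W}) (h : U -> V) :
  lin h -> lin (fun x => g (h x)).
Proof. by move=> hl a x y; rewrite hl linearP. Qed.

Lemma lin_funcomp U V W (f : V -> W) (h : U -> V) :
  lin f -> lin h -> lin (fun x => f (h x)).
Proof. by move=> fl hl a x y; rewrite hl fl. Qed.

Lemma lin_bilinl U V V' W (F : V -> V' -> W) (h : U -> V) v :
  bilin F -> lin h -> lin (fun x => F (h x) v).
Proof. by move=> [Fl _] hl a x y; rewrite hl Fl. Qed.

Lemma lin_bilinr U V V' W (F : V -> V' -> W) (h : U -> V') v :
  bilin F -> lin h -> lin (fun x => F v (h x)).
Proof. by move=> [_ Fr] hl a x y; rewrite hl Fr. Qed.

Lemma bilin_linr U V W (F : U -> V -> W) u : bilin F -> lin (F u).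
Proof. by case. Qed.

Lemma lin_trilin1 U V V' V'' W (F : V -> V' -> V'' -> W) (h : U -> V) v w :
  trilin F -> lin h -> lin (fun x => F (h x) v w).
Proof. by move=> [Fl _] hl a x y; rewrite hl Fl. Qed.

Lemma trilin_bilin U V W Z (f : U -> V -> W -> Z) u : trilin f -> bilin (f u).
Proof. by case. Qed.

Lemma lin_sub U V (f g : U -> V) : lin f -> lin g -> lin (fun x => f x - g x).
Proof. by move=> fl gl a x y; rewrite fl gl scalerBr opprD addrACA. Qed.

Lemma lin_scale U V (c : k) (f : U -> V) : lin f -> lin (fun x => c *: f x).
Proof. by move=> fl a x y; rewrite fl scalerDr !scalerA mulrC. Qed.

Lemma lin_scalel U V (f : {scalar U}) (h : V -> U) W (w : W) :
  lin h -> lin (fun x => f (h x) *: w).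
Proof. by move=> hl a x y; rewrite hl linearP /= scalerDl scalerA. Qed.

Lemma lin_sweedler U V W Z (T : Z -> (U ⊗ V)%type) (f : U -> V -> W) :
  bilin f -> lin T -> lin (fun x => sweedler (T x) f).
Proof.
by move=> /bilinP fb Tl a x y; rewrite Tl; exact: (sweedler_linear fb).
Qed.

Lemma lin_sweedler_fun U V W Z (t : (U ⊗ V)%type) (F : Z -> U -> V -> W) :
  (forall u v, lin (fun x => F x u v)) -> lin (fun x => sweedler t (F x)).
Proof.
move=> Fl a x y; rewrite /sweedler scaler_sumr -big_split /=.
by apply: eq_bigr => p _; rewrite Fl scalerDr !scalerA mulrC.
Qed.

Lemma bilin_pure U V : bilin (@pure_tensor k U V).
Proof.
have [l r] := pure_tensor_bilinear U V.
by split=> [v|u] a x y; [apply: l | apply: r].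
Qed.

Lemma bilin_bilinear U V W (f : {bilinear U -> V -> W}) : bilin f.
Proof. by split=> [v|u] a x y; [exact: linearPl | exact: linearPr]. Qed.

Lemma sweedler_ext U V W (t : (U ⊗ V)%type) (f g : U -> V -> W) :
  (forall u v, f u v = g u v) -> sweedler t f = sweedler t g.
Proof. by move=> fg; apply: eq_bigr => p _; rewrite fg. Qed.

Lemma sweedler_map U V W Z (g : W -> Z) (t : (U ⊗ V)%type) (f : U -> V -> W) :
  lin g -> g (sweedler t f) = sweedler t (fun u v => g (f u v)).
Proof.
by move=> gl; rewrite /sweedler lin_sum //; apply: eq_bigr => p _; rewrite linZ.
Qed.

Lemma sweedler_pureE U V W (f : U -> V -> W) u v :
  bilin f -> sweedler (u ⊗ v) f = f u v.
Proof. by move=> /bilinP fb; exact: sweedler_pure. Qed.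

Lemma sweedler_bind U V U' V' W (t : (U ⊗ V)%type) (s : U -> V -> (U' ⊗ V')%type)
    (f : U' -> V' -> W) :
  bilin f ->
  sweedler (sweedler t s) f = sweedler t (fun u v => sweedler (s u v) f).
Proof.
move=> fb; apply: (sweedler_map (g := fun r => sweedler r f)).
by apply: lin_sweedler => //; apply: lin_id.
Qed.

(** No bilinearity is asked of [f]: each Sweedler sum runs over one fixed representative, so this is
    an exchange of finite sums. *)
Lemma sweedler_exchange U V U' V' W (t : (U ⊗ V)%type) (s : (U' ⊗ V')%type)
    (f : U -> V -> U' -> V' -> W) :
  sweedler t (fun u v => sweedler s (f u v)) =
  sweedler s (fun u' v' => sweedler t (fun u v => f u v u' v')).
Proof.
rewrite /sweedler; under eq_bigr do rewrite scaler_sumr.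
rewrite exchange_big; apply: eq_bigr => q _; rewrite scaler_sumr.
by apply: eq_bigr => p _; rewrite !scalerA mulrC.
Qed.

Lemma sweedlerB U V W (t : (U ⊗ V)%type) (f g : U -> V -> W) :
  sweedler t (fun u v => f u v - g u v) = sweedler t f - sweedler t g.
Proof.
rewrite /sweedler -sumrB; apply: eq_bigr => p _; exact: scalerBr.
Qed.

Lemma sweedler0 U V W (t : (U ⊗ V)%type) : sweedler t (fun _ _ => 0 : W) = 0.
Proof. by rewrite /sweedler big1 // => p _; rewrite scaler0. Qed.

End Multilinear.

(* Hooks of linear_tac, redefined whenever new operations become available.   *)
Ltac bilin_known := fail.
Ltac lin_known := fail.

Ltac linear_tac :=
  cbv beta;
  lazymatch goal with
  | |- trilin _ => first
      [ assumption | split; [move=> ? ?; linear_tac | move=> ?; linear_tac] ]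
  | |- bilin _ => first
      [ assumption | apply: bilin_pure | apply: bilin_bilinear
      | bilin_known | apply: trilin_bilin; assumption
      | split; move=> ?; linear_tac ]
  (* Failing on functions that ignore their variable makes the [first] combinators backtrack to the
     argument where the variable occurs. *)
  | |- lin (fun _ => ?c) => fail
  | |- lin (fun x => x) => apply: lin_id
  | |- lin (fun x => @sweedler _ _ _ _ _ _) => first
      [ apply: lin_sweedler; [| linear_tac]; linear_tac
      | apply: lin_sweedler_fun => ? ?; linear_tac ]
  | |- lin (fun x => _ - _) => apply: lin_sub; linear_tac
  | |- lin _ => first
      [ assumption
      | lin_known
      | apply: lin_comp; linear_tac
      | apply: lin_scale; linear_tac
      | apply: lin_scalel; linear_tac
      | apply: lin_bilinl; [| linear_tac]; linear_tac
      | apply: lin_bilinr; [| linear_tac]; linear_tac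
      | apply: lin_funcomp; [assumption | linear_tac]
      | apply: lin_trilin1; [assumption | linear_tac]
      | apply: bilin_linr; linear_tac ]
  end.

(** * The untwisted Hopf algebra *)

Definition umul (k : fieldType) (H : homHopf k) (h g : H) : H :=
  autV H (hmul h g).

Definition ucomul (k : fieldType) (H : homHopf k) (h : H) : (H ⊗ H)%type :=
  comul (aut H h).

Lemma umul_bilin (k : fieldType) (H : homHopf k) : bilin (@umul k H).
Proof. by rewrite /umul; split=> [v|u]; linear_tac. Qed.

Ltac bilin_known ::= apply: umul_bilin.

Section UntwistedHopf.
Context {k : fieldType} {H : homHopf k}.
Implicit Types (f g h : H) (W : lmodType k).

Local Notation "x ∙ y" := (umul x y) (at level 40, left associativity).
Local Notation "1" := (hone H) : ring_scope.

Lemma umulA f g h : f ∙ (g ∙ h) = f ∙ g ∙ h.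
Proof.
rewrite /umul; congr (autV H _); apply: (can_inj (autK (h := H))).
by rewrite (hom_autM (hopf_algebra H)) autVK (hom_mulA (hopf_algebra H))
  (hom_autM (hopf_algebra H)) autVK.
Qed.

Lemma umul1l h : 1 ∙ h = h.
Proof. by rewrite /umul (hom_mul1r (hopf_algebra H)) autK. Qed.

Lemma umul1r h : h ∙ 1 = h.
Proof. by rewrite /umul (hom_mulr1 (hopf_algebra H)) autK. Qed.

(* Here and below, an identity between iterated coproducts is stated by       *)
(* applying an arbitrary multilinear map to its two sides.                    *)
Lemma ucomul_sum W (F : H -> H -> W) h : bilin F ->
  \tsum_(x ⊗ y <- ucomul h) F x y =
  \tsum_(x ⊗ y <- comul h) F (aut H x) (aut H y).
Proof.
move=> Fb; rewrite /ucomul (hom_comul_aut (hopf_coalgebra H)).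
rewrite sweedler_bind //; apply: sweedler_ext => x y.
by rewrite sweedler_pureE.
Qed.

Lemma ucomulA W (F : H -> H -> H -> W) h : trilin F ->
  \tsum_(x ⊗ y <- ucomul h) \tsum_(x1 ⊗ x2 <- ucomul x) F x1 x2 y =
  \tsum_(x ⊗ y <- ucomul h) \tsum_(y1 ⊗ y2 <- ucomul y) F x y1 y2.
Proof.
move=> Ft.
(* Applying α to all three legs cancels the α⁻¹ in Hom-coassociativity and turns each inner [comul]
   into [ucomul]. *)
pose G (t : (H ⊗ (H ⊗ H))%type) := \tsum_(x ⊗ u <- t) \tsum_(y ⊗ z <- u)
  F (aut H x) (aut H y) (aut H z).
have Gl : lin G.
  by rewrite /G; linear_tac.
have GE (T : H -> H -> (H ⊗ (H ⊗ H))%type) : G (\tsum_(x ⊗ y <- ucomul h) T x y) =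
    \tsum_(x ⊗ y <- ucomul h) G (T x y) by rewrite sweedler_map.
have := congr1 G (hom_coassoc (hopf_coalgebra H) (aut H h)).
rewrite !GE => E; symmetry; apply: etrans (etrans E _).
  apply: sweedler_ext => x y; rewrite /G sweedler_pureE ?autVK; last by linear_tac.
  by rewrite -ucomul_sum //; linear_tac.
apply: sweedler_ext => x y; rewrite /G.
rewrite sweedler_bind; last by linear_tac.
rewrite ucomul_sum; last by linear_tac.
apply: sweedler_ext => x1 x2; rewrite sweedler_pureE; last by linear_tac.
by rewrite sweedler_pureE ?autVK //; linear_tac.
Qed.

Lemma ucounitr W (F : H -> W) h : lin F ->
  \tsum_(x ⊗ y <- ucomul h) counit y *: F x = F h.
Proof.
move=> Fl; rewrite -[in RHS](autK h) -(hom_counitr (hopf_coalgebra H)).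
rewrite sweedler_map //.
by apply: sweedler_ext => x y; rewrite linZ.
Qed.

Lemma ucounitl W (F : H -> W) h : lin F ->
  \tsum_(x ⊗ y <- ucomul h) counit x *: F y = F h.
Proof.
move=> Fl; rewrite -[in RHS](autK h) -(hom_counitl (hopf_coalgebra H)).
rewrite sweedler_map //.
by apply: sweedler_ext => x y; rewrite linZ.
Qed.

Lemma ucomulM W (F : H -> H -> W) g h : bilin F ->
  \tsum_(x ⊗ y <- ucomul (g ∙ h)) F x y =
  \tsum_(g1 ⊗ g2 <- ucomul g) \tsum_(h1 ⊗ h2 <- ucomul h) F (g1 ∙ h1) (g2 ∙ h2).
Proof.
move=> Fb; rewrite [in LHS]/ucomul /umul autVK comulM.
rewrite sweedler_bind // [RHS]ucomul_sum; last by linear_tac.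
apply: sweedler_ext => g1 g2; rewrite sweedler_bind //.
rewrite [RHS]ucomul_sum; last by linear_tac.
apply: sweedler_ext => h1 h2; rewrite sweedler_pureE //.
by rewrite -!(hom_autM (hopf_algebra H)) !autK.
Qed.

Lemma autV_one : autV H 1 = 1.
Proof. by rewrite -[in LHS](hom_aut1 (hopf_algebra H)) autK. Qed.

Lemma uantipodel W (F : H -> W) h : lin F ->
  \tsum_(x ⊗ y <- ucomul h) F (antipode x ∙ y) = counit h *: F 1.
Proof.
move=> Fl; rewrite -linZ // -(hom_counit_aut (hopf_coalgebra H)).
rewrite -autV_one -linearZ -antipodel -sweedler_map //.
by rewrite [in RHS]sweedler_map //; exact: lin_comp (@lin_id _ _).
Qed.

Lemma uantipoder W (F : H -> W) h : lin F ->
  \tsum_(x ⊗ y <- ucomul h) F (x ∙ antipode y) = counit h *: F 1.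
Proof.
move=> Fl; rewrite -linZ // -(hom_counit_aut (hopf_coalgebra H)).
rewrite -autV_one -linearZ -antipoder -sweedler_map //.
by rewrite [in RHS]sweedler_map //; exact: lin_comp (@lin_id _ _).
Qed.

Lemma ucounitM g h : counit (g ∙ h) = counit g * counit h.
Proof.
by rewrite -(hom_counit_aut (hopf_coalgebra H)) /umul autVK counitM.
Qed.

Lemma antipode_one : antipode 1 = 1 :> H.
Proof.
have := uantipodel 1 (@lin_id _ _); rewrite /ucomul.
rewrite (hom_aut1 (hopf_algebra H)) comul1.
by rewrite sweedler_pureE ?umul1r ?counit1 ?scale1r //; linear_tac.
Qed.

(* Both sides are convolution inverses of the multiplication H ⊗ H -> H.      *)
Lemma antipodeM g h : antipode (g ∙ h) = antipode h ∙ antipode g.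
Proof.
(* [L] sums S(g₁h₁) · g₂h₂ · S(h₃)S(g₃). Collapsing the last two factors leaves S(gh); after
   coassociativity, collapsing the first two leaves S(h)S(g). *)
pose F g1 g2 g3 h1 h2 h3 :=
  antipode (g1 ∙ h1) ∙ (g2 ∙ h2 ∙ (antipode h3 ∙ antipode g3)).
pose L := \tsum_(g1 ⊗ g2 <- ucomul g) \tsum_(h1 ⊗ h2 <- ucomul h)
  \tsum_(g21 ⊗ g22 <- ucomul g2) \tsum_(h21 ⊗ h22 <- ucomul h2)
    F g1 g21 g22 h1 h21 h22.
have LE : L = antipode (g ∙ h).
  transitivity (\tsum_(g1 ⊗ g2 <- ucomul g) counit g2 *:
      \tsum_(h1 ⊗ h2 <- ucomul h) counit h2 *: antipode (g1 ∙ h1)); last first.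
    by rewrite !ucounitr //; linear_tac.
  apply: sweedler_ext => g1 g2; rewrite sweedler_map; last by linear_tac.
  apply: sweedler_ext => h1 h2.
  rewrite -[antipode _]umul1r.
  rewrite -(uantipoder (F := fun t => counit h2 *: (antipode (g1 ∙ h1) ∙ t)));
    last by linear_tac.
  apply: sweedler_ext => g21 g22.
  rewrite -[g21 in RHS]umul1r.
  rewrite -(uantipoder (F := fun t =>
    antipode (g1 ∙ h1) ∙ (g21 ∙ t ∙ antipode g22))); last by linear_tac.
  by apply: sweedler_ext => h21 h22; rewrite /F !umulA.
rewrite -LE /L.
transitivity (\tsum_(g1 ⊗ g2 <- ucomul g) \tsum_(h1 ⊗ h2 <- ucomul h)
  \tsum_(g11 ⊗ g12 <- ucomul g1) \tsum_(h11 ⊗ h12 <- ucomul h1)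
    F g11 g12 g2 h11 h12 h2); last first.
  transitivity (\tsum_(g1 ⊗ g2 <- ucomul g) counit g1 *:
      \tsum_(h1 ⊗ h2 <- ucomul h) counit h1 *: (antipode h2 ∙ antipode g2));
    last first.
    by rewrite !ucounitl //; linear_tac.
  apply: sweedler_ext => g1 g2; rewrite sweedler_map; last by linear_tac.
  apply: sweedler_ext => h1 h2; rewrite scalerA -ucounitM -[_ ∙ antipode g2]umul1l.
  rewrite -(uantipodel (F := fun t => t ∙ (antipode h2 ∙ antipode g2)));
    last by linear_tac.
  rewrite ucomulM; last by linear_tac.
  by do 2!apply: sweedler_ext => ? ?; rewrite /F !umulA.
transitivity (\tsum_(g1 ⊗ g2 <- ucomul g) \tsum_(g11 ⊗ g12 <- ucomul g1)
  \tsum_(h1 ⊗ h2 <- ucomul h) \tsum_(h11 ⊗ h12 <- ucomul h1)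
    F g11 g12 g2 h11 h12 h2); last first.
  by apply: sweedler_ext => g1 g2; exact: sweedler_exchange.
rewrite ucomulA; last by rewrite /F; linear_tac.
apply: sweedler_ext => g1 g2; rewrite sweedler_exchange.
apply: sweedler_ext => g21 g22; rewrite ucomulA //.
by rewrite /F; linear_tac.
Qed.

(** Apply S⁻¹ to h₁S(h₂) = ε(h)1; anti-multiplicativity of S reverses the product. *)
Lemma uantipodeV W (F : H -> W) h : lin F ->
  \tsum_(x ⊗ y <- ucomul h) F (y ∙ antipodeV x) = counit h *: F 1.
Proof.
move=> Fl; rewrite -[1]antipodeK antipode_one.
rewrite -(uantipoder (F := fun t => F (antipodeV t))); last by linear_tac.
apply: sweedler_ext => x y; congr F; apply: (can_inj (@antipodeK _ H)).
by rewrite antipodeVK antipodeM antipodeVK.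
Qed.

End UntwistedHopf.

(** * The untwisted Yetter-Drinfeld algebra *)

Definition uact (k : fieldType) (H : homHopf k) (M : homYDModule H)
  (h : H) (a : M) : M := autV M (act h a).

Definition ucoact (k : fieldType) (H : homHopf k) (M : homYDModule H)
  (a : M) : (H ⊗ M)%type := coact (aut M a).

Definition uamul (k : fieldType) (H : homHopf k) (A : homYDAlgebra H)
  (a b : A) : A := autV A (amul a b).

Lemma uact_bilin (k : fieldType) (H : homHopf k) (M : homYDModule H) :
  bilin (@uact k H M).
Proof. by rewrite /uact; split=> ?; linear_tac. Qed.

Lemma uamul_bilin (k : fieldType) (H : homHopf k) (A : homYDAlgebra H) :
  bilin (@uamul k H A).
Proof. by rewrite /uamul; split=> ?; linear_tac. Qed.

Ltac bilin_known ::=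
  first [apply: umul_bilin | apply: uact_bilin | apply: uamul_bilin].

Section UntwistedModule.
Context {k : fieldType} {H : homHopf k} {M : homYDModule H}.
Implicit Types (g h : H) (a b : M) (W : lmodType k).

Local Notation "x ∙ y" := (umul x y) (at level 40, left associativity).
Local Notation "h ▷ a" := (uact h a) (at level 38, right associativity).

Lemma autV_act h a : autV M (act h a) = act (autV H h) (autV M a).
Proof.
by apply: (can_inj (@autK _ M)); rewrite autVK aut_act !autVK.
Qed.

Lemma uactA g h a : g ▷ (h ▷ a) = (g ∙ h) ▷ a.
Proof.
rewrite /uact /umul; congr (autV M _).
rewrite [in RHS](_ : act _ a = autV M (act (hmul g h) (aut M a))).
  by rewrite -actA [RHS]autV_act autK.
by rewrite autV_act autK.
Qed.

Lemma uact1 a : hone H ▷ a = a.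
Proof. by rewrite /uact act1 autK. Qed.

Lemma ucoact_sum W (F : H -> M -> W) a : bilin F ->
  \tsum_(x ⊗ y <- ucoact a) F x y =
  \tsum_(x ⊗ y <- coact a) F (aut H x) (aut M y).
Proof.
move=> Fb; rewrite /ucoact coact_aut sweedler_bind //.
by apply: sweedler_ext => x y; rewrite sweedler_pureE.
Qed.

Lemma ucoactA W (F : H -> H -> M -> W) a : trilin F ->
  \tsum_(x ⊗ y <- ucoact a) \tsum_(x1 ⊗ x2 <- ucomul x) F x1 x2 y =
  \tsum_(x ⊗ y <- ucoact a) \tsum_(y1 ⊗ y2 <- ucoact y) F x y1 y2.
Proof.
move=> Ft.
pose G (t : (H ⊗ (H ⊗ M))%type) := \tsum_(x ⊗ u <- t) \tsum_(y ⊗ z <- u)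
  F (aut H x) (aut H y) (aut M z).
have Gl : lin G by rewrite /G; linear_tac.
have GE (T : H -> M -> (H ⊗ (H ⊗ M))%type) : G (\tsum_(x ⊗ y <- ucoact a) T x y) =
    \tsum_(x ⊗ y <- ucoact a) G (T x y) by rewrite sweedler_map.
have := congr1 G (coactA (aut M a)).
rewrite !GE => E; symmetry; apply: etrans (etrans (esym E) _).
  apply: sweedler_ext => x y; rewrite /G sweedler_pureE ?autVK; last by linear_tac.
  by rewrite -ucoact_sum //; linear_tac.
apply: sweedler_ext => x y; rewrite /G.
rewrite sweedler_bind; last by linear_tac.
rewrite ucomul_sum; last by linear_tac.
apply: sweedler_ext => x1 x2; rewrite sweedler_pureE; last by linear_tac.
by rewrite sweedler_pureE ?autVK //; linear_tac.
Qed.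

Lemma ucoact_counit W (F : M -> W) a : lin F ->
  \tsum_(x ⊗ y <- ucoact a) counit x *: F y = F a.
Proof.
move=> Fl; rewrite -[in RHS](autK a) -coact_counit sweedler_map //.
by apply: sweedler_ext => x y; rewrite linZ.
Qed.

Lemma ucoact_act W (F : H -> M -> W) h a : bilin F ->
  \tsum_(x ⊗ y <- ucoact (h ▷ a)) F x y =
  \tsum_(h1 ⊗ h2 <- ucomul h) \tsum_(h11 ⊗ h12 <- ucomul h1)
    \tsum_(a1 ⊗ a0 <- ucoact a) F (h11 ∙ a1 ∙ antipode h2) (h12 ▷ a0).
Proof.
move=> Fb; rewrite /ucoact /uact autVK coact_act sweedler_bind //.
rewrite [RHS]ucomul_sum; last by linear_tac.
apply: sweedler_ext => h1 h2; rewrite sweedler_bind //.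
rewrite [RHS]ucomul_sum; last by linear_tac.
rewrite -[comul (aut H h1)]/(ucomul h1) ucomul_sum; last by linear_tac.
apply: sweedler_ext => h11 h12; rewrite sweedler_bind //.
rewrite [RHS]ucoact_sum; last by linear_tac.
apply: sweedler_ext => a1 a0; rewrite sweedler_pureE //.
have aM := hom_autM (hopf_algebra H).
rewrite -aut_act autK; congr (F _ _).
(* Each of the two nested [umul] carries one α⁻¹, so α is applied twice to clear them. *)
apply: (can_inj (@autK _ H)); apply: (can_inj (@autK _ H)).
by rewrite /umul !(aM, autVK) antipode_aut.
Qed.

Lemma aut_uact h a : aut M (h ▷ a) = aut H h ▷ aut M a.
Proof. by rewrite /uact -aut_act autK autVK. Qed.

Lemma ucoact_aut W (F : H -> M -> W) a : bilin F ->
  \tsum_(x ⊗ y <- ucoact (aut M a)) F x y =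
  \tsum_(x ⊗ y <- ucoact a) F (aut H x) (aut M y).
Proof. by move=> Fb; rewrite ucoact_sum. Qed.

End UntwistedModule.

Section UntwistedAlgebra.
Context {k : fieldType} {H : homHopf k} {A : homYDAlgebra H}.
Implicit Types (g h : H) (a b c : A) (W : lmodType k).

Local Notation "x ∙ y" := (umul x y) (at level 40, left associativity).
Local Notation "h ▷ a" := (uact h a) (at level 38, right associativity).
Local Notation "a ⋆ b" := (uamul a b) (at level 40, left associativity).
Local Notation autM := (hom_autM (hyd_hom_algebra A)).

Lemma aut_uamul a b : aut A (a ⋆ b) = aut A a ⋆ aut A b.
Proof. by rewrite /uamul -autM autK autVK. Qed.

Lemma uamulA a b c : a ⋆ (b ⋆ c) = a ⋆ b ⋆ c.
Proof.
rewrite /uamul; congr (autV A _); apply: (can_inj (@autK _ A)).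
by rewrite autM autVK (hom_mulA (hyd_hom_algebra A)) autM autVK.
Qed.

Lemma uamul1l a : aone A ⋆ a = a.
Proof. by rewrite /uamul (hom_mul1r (hyd_hom_algebra A)) autK. Qed.

Lemma uact_mul h a b :
  h ▷ (a ⋆ b) = \tsum_(x ⊗ y <- ucomul h) ((x ▷ a) ⋆ (y ▷ b)).
Proof.
rewrite {1}/uact {1}/uamul -[h in LHS](autK h) -autV_act act_mul.
rewrite !sweedler_map; try by exact: lin_comp (@lin_id _ _).
apply: sweedler_ext => x y; rewrite /uamul; congr (autV A _).
by apply: (can_inj (@autK _ A)); rewrite autM !autVK.
Qed.

Lemma ucoact_mul W (F : H -> A -> W) a b : bilin F ->
  \tsum_(x ⊗ y <- ucoact (a ⋆ b)) F x y =
  \tsum_(a1 ⊗ a0 <- ucoact a) \tsum_(b1 ⊗ b0 <- ucoact b)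
    F (a1 ∙ b1) (a0 ⋆ b0).
Proof.
move=> Fb; rewrite {1}/ucoact /uamul autVK coact_mul sweedler_bind //.
rewrite [RHS]ucoact_sum; last by linear_tac.
apply: sweedler_ext => a1 a0; rewrite sweedler_bind //.
rewrite [RHS]ucoact_sum; last by linear_tac.
apply: sweedler_ext => b1 b0; rewrite sweedler_pureE //.
by rewrite /umul -autM -(hom_autM (hopf_algebra H)) !autK.
Qed.
End UntwistedAlgebra.

(** * The braiding *)

(* F ∘ C, for the braiding C. *)
Definition braid (k : fieldType) (H : homHopf k) (A : homYDAlgebra H)
    (W : lmodType k) (F : A -> A -> W) (a b : A) : W :=
  \tsum_(h ⊗ a0 <- ucoact a) F (uact h b) a0.

Lemma braid_bilin (k : fieldType) (H : homHopf k) (A : homYDAlgebra H)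
  (W : lmodType k) (F : A -> A -> W) : bilin F -> bilin (braid F).
Proof. by rewrite /braid /ucoact => Fb; split=> ?; linear_tac. Qed.

Lemma lin_braid_fun (k : fieldType) (H : homHopf k) (A : homYDAlgebra H)
    (U W : lmodType k) (F : U -> A -> A -> W) a b :
  (forall x y, lin (fun u => F u x y)) -> lin (fun u => braid (F u) a b).
Proof. by move=> Fl; apply: lin_sweedler_fun. Qed.

Ltac lin_known ::= apply: lin_braid_fun => ? ?; linear_tac.

Ltac bilin_known ::= first
  [ apply: umul_bilin | apply: uact_bilin | apply: uamul_bilin
  | apply: braid_bilin; linear_tac ].

Section Braiding.
Context {k : fieldType} {H : homHopf k} {A : homYDAlgebra H}.
Implicit Types (g h : H) (a b c : A) (W : lmodType k) (X Y : set A).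

Local Notation "x ∙ y" := (umul x y) (at level 40, left associativity).
Local Notation "h ▷ a" := (uact h a) (at level 38, right associativity).
Local Notation "a ⋆ b" := (uamul a b) (at level 40, left associativity).

Lemma braid_ext W (F G : A -> A -> W) a b :
  (forall x y, F x y = G x y) -> braid F a b = braid G a b.
Proof. by move=> FG; apply: sweedler_ext. Qed.

Lemma braid_map W (Z : lmodType k) (g : W -> Z) (F : A -> A -> W) a b :
  lin g -> g (braid F a b) = braid (fun x y => g (F x y)) a b.
Proof. exact: sweedler_map. Qed.

Lemma braidB W (F G : A -> A -> W) a b :
  braid (fun x y => F x y - G x y) a b = braid F a b - braid G a b.
Proof. exact: sweedlerB. Qed.

(** First hexagon: the coaction is multiplicative, so [a] passes [c] and then [b]. *)
Lemma braid_mull W (F : A -> A -> W) a b c : bilin F ->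
  braid F (b ⋆ c) a =
  braid (fun a1 c1 => braid (fun a2 b1 => F a2 (b1 ⋆ c1)) b a1) c a.
Proof.
move=> Fb; rewrite /braid ucoact_mul; last by linear_tac.
rewrite sweedler_exchange; apply: sweedler_ext => c1 c0.
by apply: sweedler_ext => b1 b0; rewrite uactA.
Qed.

(** Second hexagon, from coassociativity of the coaction and H-linearity of the product. *)
Lemma braid_mulr W (F : A -> A -> W) a b c : bilin F ->
  braid F a (b ⋆ c) =
  braid (fun b1 a1 => braid (fun c1 a2 => F (b1 ⋆ c1) a2) a1 c) a b.
Proof.
move=> Fb; rewrite /braid.
rewrite -(ucoactA (F := fun x y z => F ((x ▷ b) ⋆ (y ▷ c)) z)); last by linear_tac.
apply: sweedler_ext => x y; rewrite uact_mul (sweedler_map (g := F^~ y)) //.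
by linear_tac.
Qed.

Lemma braid_aut W (F : A -> A -> W) a b : bilin F ->
  braid F (aut A a) (aut A b) = braid (fun x y => F (aut A x) (aut A y)) a b.
Proof.
move=> Fb; rewrite /braid ucoact_aut; last by linear_tac.
by apply: sweedler_ext => x y; rewrite aut_uact.
Qed.

(** H-linearity of C: the coaction of h₁ ▷ a ends in an antipode that meets h₂ acting on [b], and
    the two cancel. *)
Lemma braid_act W (F : A -> A -> W) h a b : bilin F ->
  \tsum_(h1 ⊗ h2 <- ucomul h) braid F (h1 ▷ a) (h2 ▷ b) =
  \tsum_(h1 ⊗ h2 <- ucomul h) braid (fun x y => F (h1 ▷ x) (h2 ▷ y)) a b.
Proof.
move=> Fb; rewrite /braid.
pose G p t := \tsum_(p1 ⊗ p2 <- ucomul p) \tsum_(x ⊗ y <- ucoact a)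
  F ((p1 ∙ x) ▷ (t ▷ b)) (p2 ▷ y).
transitivity (\tsum_(h1 ⊗ h2 <- ucomul h) \tsum_(h11 ⊗ h12 <- ucomul h1)
    G h11 (antipode h12 ∙ h2)).
  apply: sweedler_ext => h1 h2; rewrite ucoact_act; last by linear_tac.
  by do 3!apply: sweedler_ext => ? ?; rewrite !uactA -!umulA.
rewrite (ucomulA (F := fun x y z => G x (antipode y ∙ z))); last first.
  by rewrite /G /ucomul; linear_tac.
transitivity (\tsum_(h1 ⊗ h2 <- ucomul h) counit h2 *: G h1 (hone H)).
  apply: sweedler_ext => h1 h2.
  by rewrite (uantipodel (F := G h1)) // /G; linear_tac.
rewrite ucounitr; last by rewrite /G /ucomul; linear_tac.
by do 2!apply: sweedler_ext => ? ?; rewrite uact1 uactA.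
Qed.

(** H-colinearity of C: the antipode in the coaction of a₍₋₁₎ ▷ b cancels against the coaction of
    a₀. *)
Lemma braid_coact W (F : H -> A -> A -> W) a b : trilin F ->
  braid (fun x y => \tsum_(x1 ⊗ x0 <- ucoact x) \tsum_(y1 ⊗ y0 <- ucoact y)
    F (x1 ∙ y1) x0 y0) a b =
  \tsum_(a1 ⊗ a0 <- ucoact a) \tsum_(b1 ⊗ b0 <- ucoact b)
    braid (F (a1 ∙ b1)) a0 b0.
Proof.
move=> Ft; rewrite /braid.
pose G p t r := \tsum_(p1 ⊗ p2 <- ucomul p) \tsum_(b1 ⊗ b0 <- ucoact b)
  F (p1 ∙ b1 ∙ t) (p2 ▷ b0) r.
transitivity (\tsum_(a1 ⊗ a0 <- ucoact a) \tsum_(x ⊗ y <- ucoact a0)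
    \tsum_(p ⊗ q <- ucomul a1) G p (antipode q ∙ x) y).
  apply: sweedler_ext => a1 a0; rewrite ucoact_act; last first.
    by rewrite /ucoact; linear_tac.
  rewrite [RHS]sweedler_exchange; apply: sweedler_ext => p q.
  rewrite [RHS]sweedler_exchange; apply: sweedler_ext => p1 p2.
  rewrite [RHS]sweedler_exchange; apply: sweedler_ext => b1 b0.
  by apply: sweedler_ext => x y; rewrite !umulA.
rewrite -(ucoactA (F := fun u x y => \tsum_(p ⊗ q <- ucomul u)
    G p (antipode q ∙ x) y)); last by rewrite /G /ucomul; linear_tac.
transitivity (\tsum_(a1 ⊗ a0 <- ucoact a)
    \tsum_(p ⊗ q <- ucomul a1) counit q *: G p (hone H) a0).
  apply: sweedler_ext => a1 a0.
  rewrite (ucomulA (F := fun x y z => G x (antipode y ∙ z) a0)); last first.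
    by rewrite /G /ucomul; linear_tac.
  apply: sweedler_ext => p q.
  by rewrite (uantipodel (F := fun t => G p t a0)) // /G; linear_tac.
transitivity (\tsum_(a1 ⊗ a0 <- ucoact a) G a1 (hone H) a0).
  apply: sweedler_ext => a1 a0.
  by rewrite (ucounitr (F := fun p => G p (hone H) a0)) // /G /ucomul; linear_tac.
rewrite /G (ucoactA (F := fun x y z => \tsum_(b1 ⊗ b0 <- ucoact b)
    F (x ∙ b1 ∙ hone H) (y ▷ b0) z)); last by rewrite /ucoact; linear_tac.
apply: sweedler_ext => a1 a0; rewrite sweedler_exchange.
by do 2!apply: sweedler_ext => ? ?; rewrite umul1r.
Qed.

Section Symmetric.
Hypothesis A_symmetric : braiding_symmetric A.

Lemma braid_inv W (F : A -> A -> W) a b : bilin F ->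
  braid F a b = \tsum_(x ⊗ y <- ucoact b) F y (antipodeV x ▷ a).
Proof.
move=> Fb; have E := congr1 (fun t => sweedler t F) (A_symmetric a b).
have {}E := etrans (esym (sweedler_bind _ _ Fb)) (etrans E (sweedler_bind _ _ Fb)).
apply: etrans (etrans E _); rewrite /braid ucoact_sum; try by linear_tac.
  apply: sweedler_ext => x y; rewrite (sweedler_pureE _ _ Fb).
  by rewrite /uact autV_act autK.
apply: sweedler_ext => x y; rewrite (sweedler_pureE _ _ Fb) /uact autV_act.
congr (F _ (act _ _)); apply: (can_inj (@autK _ H)).
by rewrite autVK; apply: (can_inj (@antipodeK _ H));
  rewrite antipode_aut !antipodeVK.
Qed.

(** C² = id: expand the outer C by its inverse formula and contract h₂S⁻¹(h₁). *)
Lemma braidK W (F : A -> A -> W) a b : bilin F -> braid (braid F) a b = F a b.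
Proof.
move=> Fb; rewrite braid_inv; last by linear_tac.
rewrite /braid -(ucoactA (F := fun x y z => F (y ▷ (antipodeV x ▷ a)) z));
  last by linear_tac.
rewrite -[RHS](ucoact_counit (F := fun z => F a z)); last by linear_tac.
apply: sweedler_ext => h b0.
rewrite -[a in RHS]uact1 -(uantipodeV (F := fun t => F (t ▷ a) b0));
  last by linear_tac.
by apply: sweedler_ext => x y; rewrite uactA.
Qed.

End Symmetric.

Lemma sweedler_sub (U : set A) W (f g : H -> A -> W) t :
  bilin f -> bilin g -> (forall h a, U a -> f h a = g h a) ->
  tensor_sub U t -> sweedler t f = sweedler t g.
Proof.
move=> fb gb fg; have fl := lin_sweedler fb (@lin_id _ _).
have gl := lin_sweedler gb (@lin_id _ _).
move: t; apply: span_ind => [|_ [h [a [Ua ->]]]|c x y xP yP].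
- by rewrite (lin0 fl) (lin0 gl).
- by rewrite !sweedler_pureE ?fg.
- by rewrite fl gl xP yP.
Qed.

Section Subalgebra.
Variable X : set A.
Hypothesis hX : hom_subalgebra X.

Lemma subalg_aut a : X a -> X (aut A a).
Proof. by move=> Xa; rewrite -(hsub_aut hX); exists a. Qed.

Lemma subalg_autV a : X a -> X (autV A a).
Proof. by rewrite -{1}(hsub_aut hX) => -[b Xb <-]; rewrite autK. Qed.

Lemma subalg_uact h a : X a -> X (h ▷ a).
Proof. by move=> Xa; apply/subalg_autV/(hsub_stable hX). Qed.

Lemma subalg_ucoact a : X a -> tensor_sub X (ucoact a).
Proof. by move=> Xa; apply: (hsub_costable hX); exact: subalg_aut. Qed.

End Subalgebra.

(** Stability and costability make C send X ⊗ Y into Y ⊗ X, so test maps need only agree there. *)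
Lemma braid_sub X Y W (F G : A -> A -> W) a b :
  hom_subalgebra X -> hom_subalgebra Y -> bilin F -> bilin G ->
  (forall x y, X x -> Y y -> F y x = G y x) ->
  X a -> Y b -> braid F a b = braid G a b.
Proof.
move=> hX hY Fb Gb FG Xa Yb; rewrite /braid.
apply: (sweedler_sub (U := X)); try by linear_tac.
  by move=> h x Xx; apply: FG => //; exact: subalg_uact.
exact: subalg_ucoact.
Qed.

(** The braided commutator of the untwisted product; it differs from [bracket] only by β
    ([bracketE]), so vanishing of products can be checked on it. *)
Definition ubracket a b := a ⋆ b - braid (@uamul k H A) a b.

Lemma braided_mulE a b : braided_mul a b = aut A (braid (@uamul k H A) a b).
Proof.
rewrite /braided_mul /braid ucoact_sum; last by linear_tac.
rewrite sweedler_map; last by exact: lin_comp (@lin_id _ _).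
by apply: sweedler_ext => x y; rewrite /uamul autVK /uact autV_act autK.
Qed.

Lemma bracketE a b : bracket a b = aut A (ubracket a b).
Proof. by rewrite /bracket braided_mulE linearB /uamul /= autVK. Qed.

End Braiding.

(** * Sums of two commutative subalgebras *)

Lemma ubracket_bilin (k : fieldType) (H : homHopf k) (A : homYDAlgebra H) :
  bilin (@ubracket k H A).
Proof. by rewrite /ubracket; split=> ?; linear_tac. Qed.

Ltac bilin_known ::= first
  [ apply: umul_bilin | apply: uact_bilin | apply: uamul_bilin
  | apply: ubracket_bilin | apply: braid_bilin; linear_tac ].

Section BraidedAlgebra.
Context {k : fieldType} {H : homHopf k} {A : homYDAlgebra H}.
Implicit Types (a b c d : A) (W : lmodType k).

Local Notation "a ⋆ b" := (uamul a b) (at level 40, left associativity).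
Local Notation "a ⊛ b" := (braid (@uamul k H A) a b)
  (at level 40, left associativity).
Local Notation "[ a ; b ]" := (ubracket a b).

Lemma lin_uamull b : lin (fun a => a ⋆ b).
Proof. by linear_tac. Qed.

Lemma lin_uamulr a : lin (fun b => a ⋆ b).
Proof. by linear_tac. Qed.

Lemma uamul_braidl (F : A -> A -> A) a b c :
  braid F a b ⋆ c = braid (fun x y => F x y ⋆ c) a b.
Proof. exact: braid_map (lin_uamull c). Qed.

Lemma uamul_braidr (F : A -> A -> A) a b c :
  c ⋆ braid F a b = braid (fun x y => c ⋆ F x y) a b.
Proof. exact: braid_map (lin_uamulr c). Qed.

Lemma lin_braid_mull b : lin (fun a => a ⊛ b).
Proof. by linear_tac. Qed.

Lemma lin_braid_mulr a : lin (fun b => a ⊛ b).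
Proof. by linear_tac. Qed.

Lemma braid_mulrE a b d :
  a ⊛ (b ⋆ d) = braid (fun b1 a1 => b1 ⋆ (a1 ⊛ d)) a b.
Proof.
rewrite braid_mulr; last exact: uamul_bilin.
apply: braid_ext => b1 a1; rewrite uamul_braidr.
by apply: braid_ext => d1 a2; rewrite uamulA.
Qed.

(** * Braiding one factor past two *)

Section Triple.
Variable W : lmodType k.
Implicit Types F G : A -> A -> A -> W.

(* F ∘ C₁₂ ∘ C₂₃. *)
Definition braid3 F b c a : W :=
  braid (fun a1 c1 => braid (fun a2 b1 => F a2 b1 c1) b a1) c a.

Lemma braid3B F G b c a :
  braid3 (fun x y z => F x y z - G x y z) b c a = braid3 F b c a - braid3 G b c a.
Proof.
by rewrite -braidB; apply: braid_ext => a1 c1; rewrite -braidB.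
Qed.

Lemma braid3_sub X Y F G b c a :
  hom_subalgebra X -> hom_subalgebra Y -> trilin F -> trilin G ->
  (forall x y z, X x -> Y y -> X z -> F x y z = G x y z) ->
  Y b -> X c -> X a -> braid3 F b c a = braid3 G b c a.
Proof.
move=> hX hY Ft Gt FG Yb Xc Xa; apply: (braid_sub hX hX) => //; try by linear_tac.
move=> c1 a1 Xc1 Xa1; apply: (braid_sub hY hX) => //; try by linear_tac.
by move=> y x Yy Xx; apply: FG.
Qed.

(** Moving [a] right past [b] and [c] and then back is two applications of C² = id. *)
Lemma braid3K F b c a : braiding_symmetric A -> trilin F ->
  braid (fun b1 a1 => braid (fun c1 a2 => braid3 F b1 c1 a2) a1 c) a b = F a b c.
Proof.
move=> sA Ft; transitivity (braid (braid (fun x y => F x y c)) a b).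
  apply: braid_ext => b1 a1.
  by rewrite [LHS](braidK sA (F := fun x y => braid (fun u v => F u v y) b1 x)) //;
    linear_tac.
by rewrite braidK //; linear_tac.
Qed.

End Triple.

(** * Products of two brackets vanish *)

Section Sum.
Variables X Y : set A.
Hypotheses (hX : hom_subalgebra X) (hY : hom_subalgebra Y).
Hypothesis X_commutative : forall a b, X a -> X b -> a ⊛ b = a ⋆ b.
Hypothesis Y_commutative : forall a b, Y a -> Y b -> a ⊛ b = a ⋆ b.
Hypothesis A_sum : forall a : A, exists x y : A, [/\ X x, Y y & a = (x + y)%R].
Hypothesis A_symmetric : braiding_symmetric A.

(** By the hexagon, [d] passes [c] and then meets [b] still inside Y, where the braided product is
    the product. *)
Lemma mul_braid_mul b c d : Y b -> X c -> Y d -> b ⋆ (c ⊛ d) = (b ⋆ c) ⊛ d.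
Proof.
move=> Yb Xc Yd; rewrite braid_mull; last exact: uamul_bilin.
rewrite uamul_braidr.
apply: (braid_sub hX hY) => //; try by linear_tac.
move=> c1 d1 Xc1 Yd1; rewrite uamulA -(Y_commutative Yb Yd1) uamul_braidl.
by apply: braid_ext => x y; rewrite uamulA.
Qed.

Lemma braid_mul_mul a b d : Y b -> X a -> Y d -> (b ⊛ a) ⋆ d = b ⊛ (a ⋆ d).
Proof.
move=> Yb Xa Yd; rewrite braid_mulrE uamul_braidl.
apply: (braid_sub hY hX) => //; try by linear_tac.
by move=> b1 a1 Yb1 Xa1; rewrite Y_commutative ?uamulA.
Qed.

Lemma braid3_bracket_mul b c a d : Y b -> X c -> X a -> Y d ->
  braid3 (fun x y z => [x; y] ⋆ [z; d]) b c a = 0.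
Proof.
move=> Yb Xc Xa Yd.
have [x [y [Xx Yy bcE]]] := A_sum (b ⋆ c).
have [u [v [Xu Yv adE]]] := A_sum (a ⋆ d).
have E1 : braid3 (fun x y z => (x ⋆ y) ⋆ (z ⋆ d)) b c a = ((b ⋆ c) ⊛ a) ⋆ d.
  rewrite braid_mull ?uamul_braidl; last exact: uamul_bilin.
  apply: braid_ext => a1 c1; rewrite uamul_braidl.
  by apply: braid_ext => a2 b1; rewrite !uamulA.
have E2 : braid3 (fun x y z => (x ⋆ y) ⋆ (z ⊛ d)) b c a = (b ⋆ c) ⊛ (a ⋆ d).
  rewrite braid_mulrE.
  rewrite (braid_mull (F := fun p q => p ⋆ (q ⊛ d))); last by linear_tac.
  apply: (braid3_sub (G := fun x y z => x ⋆ ((y ⋆ z) ⊛ d)) hX hY) => //;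
    try by linear_tac.
  by move=> x1 y1 z1 Xx1 Yy1 Xz1; rewrite -uamulA mul_braid_mul.
(* A braided product precomposed with C is the plain product, since C² = id. *)
have braid2 (z : A) p q : braid (fun x y => (x ⊛ y) ⋆ z) p q = (p ⋆ q) ⋆ z.
  rewrite -[RHS](braidK A_symmetric (F := fun x y => (x ⋆ y) ⋆ z));
    last by linear_tac.
  by apply: braid_ext => x1 y1; rewrite uamul_braidl.
have E3 : braid3 (fun x y z => (x ⊛ y) ⋆ (z ⋆ d)) b c a = (b ⋆ c) ⋆ (a ⋆ d).
  transitivity (b ⋆ ((c ⊛ a) ⋆ d)); last first.
    by rewrite X_commutative ?uamulA.
  rewrite [in RHS]uamul_braidl [in RHS]uamul_braidr.
  by apply: braid_ext => a1 c1; rewrite braid2 !uamulA.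
have E4 : braid3 (fun x y z => (x ⊛ y) ⋆ (z ⊛ d)) b c a = b ⋆ (c ⊛ (a ⋆ d)).
  rewrite braid_mulrE uamul_braidr.
  by apply: braid_ext => a1 c1; rewrite braid2 !uamulA.
(* Expanding both brackets gives the four terms computed in [E1] to [E4], with signs. *)
transitivity (((b ⋆ c) ⊛ a) ⋆ d - (b ⋆ c) ⊛ (a ⋆ d)
    - ((b ⋆ c) ⋆ (a ⋆ d) - b ⋆ (c ⊛ (a ⋆ d)))).
  rewrite -E1 -E2 -E3 -E4 -!braid3B; do 2!apply: braid_ext => ? ?.
  rewrite /ubracket (linB (lin_uamull _)) !(linB (lin_uamulr _)).
  by [].
have -> : ((b ⋆ c) ⊛ a) ⋆ d = x ⋆ (a ⋆ d) + y ⊛ (a ⋆ d).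
  rewrite bcE (linD (lin_braid_mull _)) (linD (lin_uamull _)).
  by rewrite X_commutative // braid_mul_mul // uamulA.
have -> : b ⋆ (c ⊛ (a ⋆ d)) = (b ⋆ c) ⋆ u + (b ⋆ c) ⊛ v.
  rewrite adE (linD (lin_braid_mulr _)) (linD (lin_uamulr _)).
  by rewrite X_commutative // mul_braid_mul // uamulA.
rewrite bcE adE !(linD (lin_braid_mull _), linD (lin_braid_mulr _)).
rewrite !(linD (lin_uamull _), linD (lin_uamulr _)).
rewrite (X_commutative Xx Xu) (Y_commutative Yy Yv).
have cancelr p q r : p + q - (r + q) = p - r :> A.
  by rewrite opprD addrACA subrr addr0.
have cancell p q r : p + q - (p + r) = q - r :> A.
  by rewrite opprD addrACA subrr add0r.
by rewrite cancelr cancell [_ + (_ ⋆ _ + _)]addrACA cancell cancelr subrr.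
Qed.

Lemma bracket_mul_sum a b c d : X a -> Y b -> X c -> Y d -> [a; b] ⋆ [c; d] = 0.
Proof.
move=> Xa Yb Xc Yd.
have Ft : trilin (fun x y z => [x; y] ⋆ [z; d]) by linear_tac.
have Z W : bilin (fun _ _ : A => 0 : W).
  by split=> ? ? ? ?; rewrite scaler0 addr0.
(* Now [braid3] is evaluated only on components in Y, X, X, where the previous lemma applies. *)
rewrite -[LHS](braid3K b c a A_symmetric Ft).
rewrite (braid_sub hX hY (G := fun _ _ => 0)) // => [||b1 a1 Xa1 Yb1]; last 1 first.
- rewrite (braid_sub hX hX (G := fun _ _ => 0)) //; first exact: sweedler0.
    by rewrite /braid3; linear_tac.
  by move=> a2 c1 Xa2 Xc1; apply: braid3_bracket_mul.
- exact: sweedler0.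
by rewrite /braid3; linear_tac.
Qed.

(** The missing case Y ⊗ X follows from X ⊗ Y, because C carries the former into the latter at the
    cost of a sign. *)
Lemma alternating_eq0 (F : A -> A -> A) a b : bilin F ->
  (forall x y, F x y = - braid F x y) ->
  (forall x x', X x -> X x' -> F x x' = 0) ->
  (forall y y', Y y -> Y y' -> F y y' = 0) ->
  (forall x y, X x -> Y y -> F x y = 0) -> F a b = 0.
Proof.
move=> Fb Falt FXX FYY FXY.
have FYX y x : Y y -> X x -> F y x = 0.
  move=> Yy Xx; rewrite Falt (braid_sub hY hX (G := fun _ _ => 0)) //.
  - by rewrite [braid _ _ _]sweedler0 oppr0.
  - by split=> ? ? ? ?; rewrite scaler0 addr0.
  by move=> y' x' Yy' Xx'; apply: FXY.
have [x [y [Xx Yy ->]]] := A_sum a; have [u [v [Xu Yv ->]]] := A_sum b.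
rewrite (linD (Fb.1 _)) !(linD (Fb.2 _)).
by rewrite (FXX x u) // (FXY x v) // (FYX y u) // (FYY y v) // !addr0.
Qed.

Lemma ubracket_braid x y : braid (@ubracket k H A) x y = - [x; y].
Proof.
rewrite braidB opprB; congr (_ - _).
by rewrite (braidK A_symmetric (F := @uamul k H A)) //; exact: uamul_bilin.
Qed.

Lemma ubracket_mul a b c d : [a; b] ⋆ [c; d] = 0.
Proof.
have altl (t x y : A) : [x; y] ⋆ t = - braid (fun x y => [x; y] ⋆ t) x y.
  by rewrite -[[x; y] in LHS]opprK -ubracket_braid
    (linN (lin_uamull _)) uamul_braidl.
have altr (t x y : A) : t ⋆ [x; y] = - braid (fun x y => t ⋆ [x; y]) x y.
  by rewrite -[[x; y] in LHS]opprK -ubracket_braid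
    (linN (lin_uamulr _)) uamul_braidr.
have XX x x' : X x -> X x' -> [x; x'] = 0.
  by move=> Xx Xx'; rewrite /ubracket X_commutative ?subrr.
have YY y y' : Y y -> Y y' -> [y; y'] = 0.
  by move=> Yy Yy'; rewrite /ubracket Y_commutative ?subrr.
have mul0 (t : A) : 0 ⋆ t = 0 := lin0 (lin_uamull t).
have mulr0 (t : A) : t ⋆ 0 = 0 := lin0 (lin_uamulr t).
apply: (alternating_eq0 (F := fun x y => [x; y] ⋆ [c; d])) => //; try by linear_tac.
- by move=> x x' Xx Xx'; rewrite (XX x x').
- by move=> y y' Yy Yy'; rewrite (YY y y').
move=> x y Xx Yy.
apply: (alternating_eq0 (F := fun u v => [x; y] ⋆ [u; v])) => //; try by linear_tac.
- by move=> u u' Xu Xu'; rewrite (XX u u').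
- by move=> v v' Yv Yv'; rewrite (YY v v').
by move=> u v Xu Yv; apply: bracket_mul_sum.
Qed.

End Sum.

(** * The Leibniz rule and [A,A]A[A,A] = 0 *)

Section SquareZero.
Hypothesis A_symmetric : braiding_symmetric A.
Hypothesis square_zero : forall a b c d, [a; b] ⋆ [c; d] = 0.

Lemma ubracket_mulr a b c :
  [a; b ⋆ c] = [a; b] ⋆ c + braid (fun b1 a1 => b1 ⋆ [a1; c]) a b.
Proof.
rewrite /ubracket braid_mulrE (linB (lin_uamull c)) uamul_braidl.
have -> : braid (fun b1 a1 => b1 ⋆ (a1 ⋆ c - a1 ⊛ c)) a b =
    braid (fun b1 a1 => b1 ⋆ a1 ⋆ c) a b - braid (fun b1 a1 => b1 ⋆ (a1 ⊛ c)) a b.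
  by rewrite -braidB; apply: braid_ext => x y; rewrite (linB (lin_uamulr x)) uamulA.
by rewrite addrA subrK uamulA.
Qed.

Lemma ubracket_mul_mul a b c d e : [a; b] ⋆ (c ⋆ [d; e]) = 0.
Proof.
pose F x y := [a; b] ⋆ (x ⋆ [y; e]).
have Fb : bilin F by rewrite /F; linear_tac.
(* By C² = id, F(c,d) is a sum of values of F∘C, and these are the second Leibniz term of [x; y ⋆ e]
   multiplied by [a; b]. *)
rewrite -[LHS]/(F c d) -(braidK A_symmetric c d Fb).
rewrite (braid_ext (G := fun _ _ => 0)) ?[LHS]sweedler0 // => x y.
rewrite -uamul_braidr.
have := square_zero a b x (y ⋆ e).
by rewrite ubracket_mulr (linD (lin_uamulr _)) uamulA square_zero
  (lin0 (lin_uamull _)) add0r.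
Qed.

End SquareZero.
End BraidedAlgebra.

(** * The ideal generated by the brackets *)

Section BracketIdeal.
Context {k : fieldType} {H : homHopf k} {A : homYDAlgebra H}.
Implicit Types (h : H) (a b c d : A) (W : lmodType k) (U : set A).

Local Notation "x ∙ y" := (umul x y) (at level 40, left associativity).
Local Notation "h ▷ a" := (uact h a) (at level 38, right associativity).
Local Notation "a ⋆ b" := (uamul a b) (at level 40, left associativity).
Local Notation "[ a ; b ]" := (ubracket a b).

Lemma aut_ubracket a b : aut A [a; b] = [aut A a; aut A b].
Proof.
rewrite /ubracket linearB /= aut_uamul; congr (_ - _).
rewrite braid_aut; last exact: uamul_bilin.
rewrite braid_map; last exact: lin_comp (@lin_id _ _).
by apply: braid_ext => x y; rewrite aut_uamul.
Qed.

Lemma uact_ubracket h a b :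
  h ▷ [a; b] = \tsum_(x ⊗ y <- ucomul h) [x ▷ a; y ▷ b].
Proof.
rewrite /ubracket sweedlerB (linB (f := uact h)); last by linear_tac.
rewrite uact_mul braid_act; last exact: uamul_bilin.
congr (_ - _); rewrite braid_map; last by linear_tac.
rewrite [in RHS]/braid sweedler_exchange /braid.
by apply: sweedler_ext => x y; rewrite uact_mul.
Qed.

Lemma ucoact_ubracket W (F : H -> A -> W) a b : bilin F ->
  \tsum_(x ⊗ y <- ucoact [a; b]) F x y =
  \tsum_(a1 ⊗ a0 <- ucoact a) \tsum_(b1 ⊗ b0 <- ucoact b) F (a1 ∙ b1) [a0; b0].
Proof.
move=> Fb; pose G c := \tsum_(x ⊗ y <- ucoact c) F x y.
have Gl : lin G by rewrite /G /ucoact; linear_tac.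
rewrite -[LHS]/(G _) /ubracket (linB Gl) /G ucoact_mul //.
rewrite -[sweedler (ucoact (braid _ a b)) _]/(G _) braid_map //.
transitivity (
  \tsum_(a1 ⊗ a0 <- ucoact a) \tsum_(b1 ⊗ b0 <- ucoact b)
      F (a1 ∙ b1) (a0 ⋆ b0)
  - \tsum_(a1 ⊗ a0 <- ucoact a) \tsum_(b1 ⊗ b0 <- ucoact b)
      braid (fun x y => F (a1 ∙ b1) (x ⋆ y)) a0 b0).
  congr (_ - _); rewrite -(braid_coact (F := fun h x y => F h (x ⋆ y)));
    last by linear_tac.
  by apply: braid_ext => x y; rewrite /G ucoact_mul.
rewrite -sweedlerB; apply: sweedler_ext => a1 a0.
rewrite -sweedlerB; apply: sweedler_ext => b1 b0.
by rewrite (linB (Fb.2 _)) -braid_map //; case: Fb.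
Qed.

Lemma subspace_sweedler (V V' W : lmodType k) (U : set W) (t : (V ⊗ V')%type)
    (F : V -> V' -> W) :
  subspace U -> (forall x y, U (F x y)) -> U (sweedler t F).
Proof.
move=> [U0 UD] UF; rewrite /sweedler.
by apply: (big_ind U) => // [x y Ux Uy|p _];
  [rewrite -[x]scale1r | rewrite -[_ *: _]addr0]; apply: UD.
Qed.

(** Turns identities stated through a bilinear test map into equalities of tensors. *)
Lemma sweedler_id (V V' : lmodType k) (t : (V ⊗ V')%type) :
  \tsum_(x ⊗ y <- t) (x ⊗ y) = t.
Proof.
have l := lin_sweedler (@bilin_pure _ V V') (@lin_id _ _).
move: t; apply: tensor_ind => [|u v|c s t sE tE]; first exact: (lin0 l).
  by rewrite sweedler_pureE //; exact: bilin_pure.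
by rewrite [LHS]l sE tE.
Qed.

Lemma span_map (V V' : lmodType k) (S : set V) (U : set V') (f : V -> V') :
  lin f -> subspace U -> (forall x, S x -> U (f x)) ->
  forall x, Defs.span S x -> U (f x).
Proof.
move=> fl [U0 UD] SU; apply: span_ind => [|//|c x y Ux Uy]; first by rewrite lin0.
by rewrite fl; apply: UD.
Qed.

(** Hom-associativity moves the brackets up to β on the outer factors, which is absorbed because β
    is bijective on A. *)
Lemma mul_spanA U :
  mul_span (mul_span setT U) setT = mul_span setT (mul_span U setT).
Proof.
have mA := hom_mulA (hyd_hom_algebra A).
have sub (S S' : set A) : subspace (mul_span S S') by exact: span_subspace.
rewrite eqEsubset; split; apply: span_min => // _ [p [q [pU qU ->]]].
  move: p pU; apply: (span_map (f := fun p => amul p q)) => //; first by linear_tac.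
  move=> _ [a [u [_ Uu ->]]]; rewrite -[q](autVK (h := A)) -mA.
  apply: Defs.sub_span; exists (aut A a), (amul u (autV A q)); split=> //.
  by apply: Defs.sub_span; exists u, (autV A q).
move: q qU; apply: (span_map (f := fun q => amul p q)) => //; first by linear_tac.
move=> _ [u [b [Uu _ ->]]]; rewrite -[p](autVK (h := A)) mA.
apply: Defs.sub_span; exists (amul (autV A p) u), (aut A b); split=> //.
by apply: Defs.sub_span; exists (autV A p), u.
Qed.

(** A[A,A] needs only left multiples: the Leibniz rule makes it two-sided ([bracket_ideal_mulr]). *)
Definition bracket_ideal : set A :=
  Defs.span [set c | exists a p q, c = a ⋆ [p; q]].

Let ideal_subspace : subspace bracket_ideal := span_subspace _.

Lemma bracket_ideal_gen a p q : bracket_ideal (a ⋆ [p; q]).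
Proof. by apply: Defs.sub_span; exists a, p, q. Qed.

Lemma bracket_ideal_bracket p q : bracket_ideal [p; q].
Proof. by rewrite -[[p; q]]uamul1l; apply: bracket_ideal_gen. Qed.

Lemma bracket_ideal_mull a c : bracket_ideal c -> bracket_ideal (a ⋆ c).
Proof.
move: c; apply: span_map => //; first exact: lin_uamulr.
by move=> _ [b [p [q ->]]]; rewrite uamulA; exact: bracket_ideal_gen.
Qed.

(** By Leibniz, [p,q]d is [p,qd] minus a sum of left multiples of brackets. *)
Lemma bracket_ideal_mulr c d : bracket_ideal c -> bracket_ideal (c ⋆ d).
Proof.
move: c; apply: span_map => //; first exact: lin_uamull.
move=> _ [a [p [q ->]]]; rewrite -uamulA; apply: bracket_ideal_mull.
have /(canRL (addrK _)) -> := esym (ubracket_mulr p q d).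
have [_ UD] := ideal_subspace; rewrite addrC -scaleN1r; apply: UD.
  by apply: subspace_sweedler => // x y; exact: bracket_ideal_gen.
exact: bracket_ideal_bracket.
Qed.

Lemma bracket_ideal_aut c : bracket_ideal c -> bracket_ideal (aut A c).
Proof.
move: c; apply: span_map => //; first exact: lin_comp (@lin_id _ _).
move=> _ [a [p [q ->]]]; rewrite aut_uamul aut_ubracket.
exact: bracket_ideal_gen.
Qed.

Lemma bracket_ideal_autV c : bracket_ideal c -> bracket_ideal (autV A c).
Proof.
move: c; apply: span_map => //; first exact: lin_comp (@lin_id _ _).
move=> _ [a [p [q ->]]].
rewrite -[a]autVK -[p]autVK -[q]autVK -aut_ubracket -aut_uamul autK.
exact: bracket_ideal_gen.
Qed.

Lemma bracket_ideal_act h c : bracket_ideal c -> bracket_ideal (act h c).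
Proof.
move=> Ic; rewrite -[act h c]autVK; apply: bracket_ideal_aut; move: c Ic.
apply: (span_map (f := uact h)) => //; first by linear_tac.
move=> _ [a [p [q ->]]]; rewrite uact_mul.
apply: subspace_sweedler => // x y; apply: bracket_ideal_mull.
rewrite uact_ubracket; apply: subspace_sweedler => // u v.
exact: bracket_ideal_bracket.
Qed.

Lemma bracket_ideal_coact c : bracket_ideal c -> tensor_sub bracket_ideal (coact c).
Proof.
(* [coact c] is [ucoact] at β⁻¹(c), which again lies in the ideal. *)
move=> Ic; rewrite -[c]autVK; move: (bracket_ideal_autV Ic).
rewrite -[coact _]/(ucoact (autV A c)); move: (autV A c).
have sub : subspace (tensor_sub bracket_ideal) by exact: span_subspace.
apply: (span_map (f := @ucoact k H A)) => //.
  by rewrite /ucoact; linear_tac.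
move=> _ [a [p [q ->]]]; rewrite -[ucoact _]sweedler_id ucoact_mul;
  last by linear_tac.
apply: subspace_sweedler => // a1 a0; rewrite ucoact_ubracket; last by linear_tac.
do 2!apply: subspace_sweedler => // ? ?.
apply: Defs.sub_span; do 2!eexists; split; last by reflexivity.
exact: bracket_ideal_gen.
Qed.

Lemma bracket_ideal_hom_ideal : H_hom_ideal bracket_ideal.
Proof.
split=> //; first by move=> h a; exact: bracket_ideal_act.
- exact: bracket_ideal_coact.
- exact: bracket_ideal_aut.
- exact: mul_spanA.
have mulE a b : amul a b = aut A (a ⋆ b) by rewrite /uamul autVK.
apply: span_min => // _ [p [q [pI _ ->]]]; move: p pI.
apply: (span_map (f := fun p => amul p q)) => //; first by linear_tac.
move=> _ [a [u [_ Iu ->]]]; rewrite !mulE; apply: bracket_ideal_aut.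
apply: bracket_ideal_mulr; apply: bracket_ideal_aut.
exact: bracket_ideal_mull.
Qed.

(** Lengths in [product_of] are positive, so length 2 can only split as 1 + 1. *)
Lemma nilpotent_square_zero U :
  (forall a b, U a -> U b -> amul a b = 0) -> nilpotent U.
Proof.
move=> UU; exists 2%N => // a.
have pos n b : product_of U n b -> (0 < n)%N.
  by elim=> // m m' ? ? _ m0 _ _; rewrite addn_gt0 m0.
have one b : product_of U 1 b -> U b.
  move E : 1%N => n bP; case: bP E => // m m' b1 b2 /pos m0 /pos m'0 E.
  by have := leq_add m0 m'0; rewrite -E.
move E : 2%N => n aP; case: aP E => [b _ //|m m' b c bP cP E].
have [m0 m'0] := (pos _ _ bP, pos _ _ cP).
have m1 : m = 1%N.
  by apply/eqP; rewrite eqn_leq m0 andbT -(leq_add2r m') -E ltnS.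
have m'1 : m' = 1%N by apply/eqP; rewrite -(eqn_add2l m) -E m1.
by subst; apply: UU; exact: one.
Qed.

Lemma nilpotent_span (S : set A) :
  (forall c d, S c -> S d -> c ⋆ d = 0) -> nilpotent (Defs.span S).
Proof.
have sub0 : subspace [set 0 : A].
  by split=> // c a b -> ->; rewrite scaler0 addr0.
move=> S0; apply: nilpotent_square_zero => a b aS bS.
suff ab0 : a ⋆ b = 0 by rewrite -[amul a b]autVK -/(a ⋆ b) ab0 linear0.
move: a aS; apply: (span_map (U := [set 0]) (f := fun a => a ⋆ b)) => //.
  exact: lin_uamull.
move=> a Sa; move: b bS; apply: (span_map (U := [set 0])) => //.
  exact: lin_uamulr.
by move=> b Sb; apply: S0.
Qed.

Lemma H_commutative_braid U : H_commutative U ->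
  forall a b, U a -> U b -> braid (@uamul k H A) a b = a ⋆ b.
Proof.
move=> UC a b Ua Ub; apply: (can_inj (@autK _ A)).
by rewrite -braided_mulE UC // /uamul autVK.
Qed.

End BracketIdeal.

Theorem corollary2p9 (k : fieldType) (H : homHopf k) (A : homYDAlgebra H)
    (X Y : set A)
    (X_subalgebra : hom_subalgebra X) (Y_subalgebra : hom_subalgebra Y)
    (X_commutative : H_commutative X) (Y_commutative : H_commutative Y)
    (A_sum : forall a : A, exists x y : A, [/\ X x, Y y & a = (x + y)%R])
    (A_symmetric : braiding_symmetric A) :
  nilpotent (commutator_span A) /\
  (H_semiprime A -> H_commutative (setT : set A)).
Proof.
have square_zero := ubracket_mul X_subalgebra Y_subalgebra
  (H_commutative_braid X_commutative) (H_commutative_braid Y_commutative)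
  A_sum A_symmetric.
split.
  apply: nilpotent_span => _ _ [a [b ->]] [c [d ->]].
  by rewrite !bracketE -aut_uamul square_zero linear0.
move=> /(_ _ bracket_ideal_hom_ideal) semiprime a b _ _.
(* The ideal squares to zero because [A,A]A[A,A] = 0, so semiprimeness forces it, and every bracket
   in it, to vanish. *)
have I0 : bracket_ideal `<=` [set 0 : A].
  apply: semiprime; apply: nilpotent_span => _ _ [a1 [p [q ->]]] [c [r [s ->]]].
  rewrite -uamulA (ubracket_mul_mul A_symmetric square_zero).
  exact: lin0 (lin_uamulr _).
have /I0/(congr1 (aut A)) := bracket_ideal_bracket a b.
by rewrite -bracketE linear0 => /eqP; rewrite subr_eq0 => /eqP ->.
Qed.
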